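(* Let $d\in\mathbb{N}$ be odd. For all $\mathbf{s}=(s_1,\dots,s_d)\in\mathbb{N}^d$, the following identity holds in $\mathcal{A}$: $$T_{\mathcal{A}}(1,\mathbf{s})+T_{\mathcal{A}}(\mathbf{s},1)+\sum_{j=1}^d\sum_{a=1}^{s_j}T_{\mathcal{A}}(s_1,\dots,s_{j-1},a,s_j+1-a,s_{j+1},\dots,s_d)=0.$$
   Context: $\mathbb{N}$ is the set of positive integers, $\mathcal{P}$ the set of primes, and $\mathcal{A}:=\prod_{p\in\mathcal{P}}(\mathbb{Z}/p\mathbb{Z})\big/\bigoplus_{p\in\mathcal{P}}(\mathbb{Z}/p\mathbb{Z})$, so that equality in $\mathcal{A}$ means equality of components for all but finitely many $p$. Finite multiple $T$-values: for $\mathbf{s}=(s_1,\dots,s_d)\in\mathbb{N}^d$, $$T_{\mathcal{A}}(\mathbf{s}):=\Bigg(\sum_{\substack{p>n_1>\dots>n_d>0\\ n_j\equiv d-j+1\ (\mathrm{mod}\ 2)}}\ \prod_{j=1}^d\frac{1}{n_j^{s_j}}\ (\mathrm{mod}\ p)\Bigg)_{p\in\mathcal{P}}\in\mathcal{A}.$$ $(1,\mathbf{s})$ and $(\mathbf{s},1)$ denote $(1,s_1,\dots,s_d)$ and $(s_1,\dots,s_d,1)$. *)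

(* Defs.v *)
From HB Require Import structures.
From mathcomp Require Import all_boot all_order all_algebra ring_quotient.
From mathcomp Require Import boolp classical_sets cardinality.

Set Implicit Arguments.
Unset Strict Implicit.
Unset Printing Implicit Defensive.
Import GRing.Theory.
Local Open Scope ring_scope.
Local Open Scope quotient_scope.

Definition primeT := {p : nat | prime p}.

Definition prodFp := forall p : primeT, 'F_(val p).

HB.instance Definition _ := gen_eqMixin prodFp.
HB.instance Definition _ := gen_choiceMixin prodFp.

Section ProdRing.
Implicit Types x y z : prodFp.

Definition prodFp_zero : prodFp := fun _ => 0.
Definition prodFp_one : prodFp := fun _ => 1.
Definition prodFp_opp x : prodFp := fun p => - x p.
Definition prodFp_add x y : prodFp := fun p => x p + y p.
Definition prodFp_mul x y : prodFp := fun p => x p * y p.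

Fact prodFp_addA : associative prodFp_add.
Proof. by move=> x y z; apply: functional_extensionality_dep => p; apply: addrA. Qed.
Fact prodFp_addC : commutative prodFp_add.
Proof. by move=> x y; apply: functional_extensionality_dep => p; apply: addrC. Qed.
Fact prodFp_add0 : left_id prodFp_zero prodFp_add.
Proof. by move=> x; apply: functional_extensionality_dep => p; apply: add0r. Qed.
Fact prodFp_addN : left_inverse prodFp_zero prodFp_opp prodFp_add.
Proof. by move=> x; apply: functional_extensionality_dep => p; apply: addNr. Qed.

HB.instance Definition _ :=
  GRing.isZmodule.Build prodFp prodFp_addA prodFp_addC prodFp_add0 prodFp_addN.

Fact prodFp_mulA : associative prodFp_mul.
Proof. by move=> x y z; apply: functional_extensionality_dep => p; apply: mulrA. Qed.
Fact prodFp_mulC : commutative prodFp_mul.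
Proof. by move=> x y; apply: functional_extensionality_dep => p; apply: mulrC. Qed.
Fact prodFp_mul1 : left_id prodFp_one prodFp_mul.
Proof. by move=> x; apply: functional_extensionality_dep => p; apply: mul1r. Qed.
Fact prodFp_mulDl : left_distributive prodFp_mul +%R.
Proof. by move=> x y z; apply: functional_extensionality_dep => p; apply: mulrDl. Qed.
Fact prodFp_neq0 : prodFp_one != 0.
Proof.
apply/eqP => /(congr1 (fun x : prodFp => x (exist (fun p => prime p) 2 isT))).
by move/eqP; rewrite (negPf (oner_neq0 _)).
Qed.

HB.instance Definition _ := GRing.Zmodule_isComNzRing.Build prodFp
  prodFp_mulA prodFp_mulC prodFp_mul1 prodFp_mulDl prodFp_neq0.

End ProdRing.

Lemma prodFp_subE (x y : prodFp) p : (x - y) p = x p - y p.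
Proof. by []. Qed.

(* The direct sum of the 'F_p, as the ideal of families with finite support. *)
Definition sumFp : {pred prodFp} :=
  [pred x : prodFp | `[< finite_set [set p | x p != 0] >]].

Lemma infinite_primeT : ~ finite_set [set: primeT].
Proof.
move=> /(finite_image val) /finite_seqP [s defs].
have [p lt_p pr_p] := prime_above (\max_(i <- s) i).
have : [set val q | q in [set: primeT]]%classic p by exists (exist _ p pr_p).
rewrite defs /= => p_s.
by have := @leq_bigmax_seq _ s xpredT (fun i => i) p p_s isT; rewrite leqNgt lt_p.
Qed.

Fact sumFp_idealr : idealr_closed sumFp.
Proof.
split=> [||a x y /asboolP fx /asboolP fy].
- apply/asboolP; rewrite (_ : [set _ | _] = set0)%classic //.
  by apply/seteqP; split=> p //=; rewrite eqxx.
- apply/negP => /asboolP; rewrite (_ : [set _ | _] = setT)%classic.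
    exact: infinite_primeT.
  by apply/seteqP; split=> p //= _; apply: oner_neq0.
- apply/asboolP; apply: (@sub_finite_set _ _
    ([set p | x p != 0] `|` [set p | y p != 0])%classic).
    move=> p /=; rewrite [X in X != _](_ : _ = a p * x p + y p) //.
    by case: (eqVneq (x p) 0) => [->|]; [rewrite mulr0 add0r; right | left].
  by rewrite finite_setU.
Qed.
HB.instance Definition _ := isIdealr.Build prodFp sumFp sumFp_idealr.

Definition calA := {ideal_quot sumFp}.
HB.instance Definition _ := GRing.ComNzRing.on calA.
HB.instance Definition _ := EqQuotient.on calA.

Lemma calA_eqP (x y : prodFp) :
  \pi_calA x = \pi_calA y <-> finite_set [set p | x p != y p].
Proof.
rewrite (_ : [set p | x p != y p] = [set p | (x - y) p != 0])%classic.
  split=> [/eqP|fxy]; first by rewrite piE => /asboolP.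
  by apply/eqP; rewrite piE; apply/asboolP.
by apply/seteqP; split=> p /=; rewrite prodFp_subE subr_eq0.
Qed.

(* The indices of n and s start at 0, so that the paper's n_j and s_j are
   tnth n (j - 1) and nth 0 s (j - 1), and d - j + 1 becomes size s - j.
   For p prime every n_j is a unit of 'F_p, since 0 < n_j < p. *)
Definition T_p (s : seq nat) (p : nat) : 'F_p :=
  \sum_(n : (size s).-tuple 'I_p |
      [&& sorted gtn (map val n), all (fun i : 'I_p => 0 < i)%N n
        & [forall j, (tnth n j == size s - j %[mod 2])%N]])
    \prod_(j < size s) ((tnth n j)%:R ^+ nth 0%N s j)^-1.

Definition T_A (s : seq nat) : calA := \pi_calA (fun p : primeT => T_p s (val p)).

(* Main.v *)
Require Import Defs.
From mathcomp Require Import all_boot all_order all_algebra.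
From mathcomp Require Import classical_sets cardinality zify ring.

Import GRing.Theory.
Local Open Scope ring_scope.

(** Put $g = \sum_{n \text{ odd}} t^n$ and $\lambda = \sum_{n \text{ odd}} t^n/n$,
    so that $\theta\lambda = g$ with $\theta = t\,d/dt$, and let $L(s)$ be the
    power series in which the coefficient of $t^n$ is the part of the sum
    defining $T(s)$ with $n_1 = n$. Then $\theta^k L(k, s) = g L(s)$, and since
    $\theta$ is a derivation, $\lambda L(s)$ is the sum of the $L(s')$ over the
    depth-raising insertions $s'$ of an index into $s$ (the shuffle product with
    a letter). Comparing the coefficients of $t^p$ in
    $\theta(\lambda L(1, s)) = \lambda g L(s) + g L(1, s)$, the left-hand side is
    a multiple of $p$, and the right-hand side is the sum in the theorem, because
    the coefficient of $t^p$ in $g L(s')$ is $T_p(s')$ when the depth of $s'$ is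
    even and $p$ is odd. *)

Section Convolution.
Context {F : fieldType}.
Implicit Types a b f g : nat -> F.

(* The coefficients of the product of two series, the first of which has no
   constant term. *)
Definition conv a f (n : nat) : F := \sum_(0 <= m < n) a (n - m)%N * f m.

Lemma eq_conv a f g n : (forall m, (m < n)%N -> f m = g m) -> conv a f n = conv a g n.
Proof. by move=> fg; apply: eq_big_nat => m /andP[_ /fg->]. Qed.

Lemma convD a f g n : conv a (fun m => f m + g m) n = conv a f n + conv a g n.
Proof. by rewrite -big_split; apply: eq_bigr => m _; rewrite mulrDr. Qed.

Lemma conv_sum a (I : Type) (r : seq I) (f : I -> nat -> F) n :
  conv a (fun m => \sum_(i <- r) f i m) n = \sum_(i <- r) conv a (f i) n.
Proof. by rewrite exchange_big; apply: eq_bigr => m _; rewrite mulr_sumr. Qed.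

Lemma convC a b f n : conv a (conv b f) n = conv b (conv a f) n.
Proof.
have convE a' b' : conv a' (conv b' f) n =
    \sum_(0 <= k < n) (\sum_(k.+1 <= m < n) a' (n - m)%N * b' (m - k)%N) * f k.
  transitivity (\sum_(0 <= m < n) \sum_(0 <= k < n | (k < m)%N)
                  a' (n - m)%N * (b' (m - k)%N * f k)).
    apply: eq_big_nat => m /andP[_ /ltnW le_mn].
    by rewrite mulr_sumr (big_nat_widen _ _ _ _ _ le_mn).
  rewrite (exchange_big_dep_nat xpredT) //=; apply: eq_bigr => k _.
  rewrite [in RHS]mulr_suml [RHS](big_nat_widenl _ 0%N) //.
  by apply: eq_bigr => m _; rewrite mulrA.
rewrite !convE; apply: eq_bigr => k _; congr (_ * _).
(* The reflection $m \mapsto k + n - m$ of the inner range exchanges the roles of [a] and [b]. *)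
rewrite big_nat_rev; apply: eq_big_nat => m /andP[lt_km lt_mn].
by rewrite mulrC; congr (b _ * a _); lia.
Qed.

Definition odd_coef (n : nat) : F := (odd n)%:R.
Definition odd_log_coef (n : nat) : F := (odd n)%:R / n%:R.

(** The coefficients of $L(s)$. Parity is imposed on the differences $n_j - n_{j+1}$, all odd with
    $n_{d+1} = 0$, which amounts to $n_j \equiv d - j + 1$ mod 2. *)
Fixpoint T_coef (s : seq nat) (n : nat) : F :=
  if s is k :: s' then (n%:R ^+ k)^-1 * conv odd_coef (T_coef s') n
  else (n == 0%N)%:R.

Lemma T_coef_cons0 k s : T_coef (k :: s) 0 = 0.
Proof. by rewrite /= /conv big_geq // mulr0. Qed.

Lemma T_coef_exp0 s n : T_coef (0%N :: s) n = conv odd_coef (T_coef s) n.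
Proof. by rewrite /= expr0 invr1 mul1r. Qed.

Lemma conv_odd_coef f n :
  conv odd_coef f n = \sum_(0 <= m < n | odd (n - m)) f m.
Proof.
rewrite [RHS]big_mkcond; apply: eq_bigr => m _.
by rewrite /odd_coef; case: odd; rewrite ?mul1r ?mul0r.
Qed.

Lemma conv_T_coef_nil a n : (0 < n)%N -> conv a (T_coef [::]) n = a n.
Proof.
move=> n_gt0; rewrite /conv big_ltn // subn0 mulr1 big_nat big1 ?addr0 //.
by move=> [|m] //= _; rewrite mulr0.
Qed.

Section Characteristic.
Variable p : nat.
Hypothesis charFp : p \in [pchar F].

Lemma natf_lt_neq0 n : (0 < n < p)%N -> n%:R != 0 :> F.
Proof.
case/andP=> n_gt0 lt_np; rewrite -(dvdn_pcharf charFp).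
by apply/negP => /(dvdn_leq n_gt0); rewrite leqNgt lt_np.
Qed.

Lemma T_coefS k s n : (n < p)%N -> n%:R * T_coef (k.+1 :: s) n = T_coef (k :: s) n.
Proof.
case: n => [|n] lt_np; first by rewrite !T_coef_cons0 mulr0.
rewrite /= exprS invfM !mulrA mulfV ?mul1r //.
by apply: natf_lt_neq0.
Qed.

Lemma T_coef1 s n : (n < p)%N -> n%:R * T_coef (1%N :: s) n = conv odd_coef (T_coef s) n.
Proof. by move=> lt_np; rewrite T_coefS // T_coef_exp0. Qed.

(* The Leibniz rule for [n |-> n%:R * _]. The vanishing of [f 0] is needed for
   [n = p], since the coefficient [odd_log_coef p] is then a junk value. *)
Lemma conv_odd_log_derive f n : f 0%N = 0 -> (n <= p)%N ->
  n%:R * conv odd_log_coef f n =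
    conv odd_log_coef (fun m => m%:R * f m) n + conv odd_coef f n.
Proof.
move=> f0 le_np; rewrite mulr_sumr -big_split; apply: eq_big_nat => -[|m] /= lt_mn.
  by rewrite f0 !mulr0 addr0.
have nz : (n - m.+1)%:R != 0 :> F by apply: natf_lt_neq0; lia.
rewrite -{1}(subnK (ltnW lt_mn)) natrD /odd_log_coef /odd_coef.
by field.
Qed.

(** Induction on [k] by applying $\theta$, which is injective on coefficients of index $0 < n < p$.
    For exponent 0 the formula says that the factors $\lambda$ and $g$ commute. *)
Lemma conv_odd_log_T_coef_cons k s n : (n < p)%N ->
  conv odd_log_coef (T_coef (k :: s)) n =
    \sum_(1 <= a < k.+1) T_coef (a :: (k + 1 - a)%N :: s) n
    + (n%:R ^+ k)^-1 * conv odd_coef (conv odd_log_coef (T_coef s)) n.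
Proof.
case: n => [|n].
  by rewrite big1 => [|a _]; rewrite ?T_coef_cons0 // /conv !big_geq // mulr0 addr0.
elim: k => [|k IHk] lt_np.
  rewrite big_geq // add0r expr0 invr1 mul1r -convC.
  by apply: eq_conv => m _; apply: T_coef_exp0.
have nz : n.+1%:R != 0 :> F by apply: natf_lt_neq0.
apply: (mulfI nz); rewrite conv_odd_log_derive ?T_coef_cons0 ?(ltnW lt_np) //.
rewrite (eq_conv _ _ (T_coef (k :: s))); last first.
  by move=> m lt_mn; apply/T_coefS/(ltn_trans lt_mn).
(* The summand $a = 1$ accounts for $g L(k+1, s)$; in the others $\theta$ lowers the first
   exponent. *)
rewrite IHk // [in RHS]big_nat_recl // addnK !mulrDr T_coef1 //.
rewrite exprS invfM !mulrA mulfV // mul1r addrC addrA; congr (_ + _ + _).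
by rewrite mulr_sumr; apply: eq_bigr => a _; rewrite T_coefS // addSn subSS.
Qed.

(** Induction on [s]: the insertions at the first entry come from [conv_odd_log_T_coef_cons], the
    other terms from the formula for the tail, with [k] put in front by linearity. The empty case is
    $\lambda = L(1)$. *)
Lemma conv_odd_log_T_coef s n : (n < p)%N ->
  conv odd_log_coef (T_coef s) n =
    T_coef (rcons s 1%N) n
    + \sum_(j < size s) \sum_(1 <= a < (nth 0 s j).+1)
        T_coef (take j s ++ [:: a; (nth 0 s j + 1 - a)%N] ++ drop j.+1 s) n.
Proof.
elim: s n => [|k s IHs] n lt_np.
  rewrite big_ord0 addr0; case: n lt_np => [|n] lt_np; first by rewrite T_coef_cons0 /conv big_geq.
  by rewrite /= !conv_T_coef_nil // expr1 mulrC.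
rewrite conv_odd_log_T_coef_cons // big_ord_recl /= drop0 addrCA; congr (_ + _).
rewrite (eq_conv _ _ _ _ (fun m lt_mn => IHs m (ltn_trans lt_mn lt_np))) convD mulrDr.
congr (_ + _); rewrite conv_sum mulr_sumr; apply: eq_bigr => j _.
by rewrite conv_sum mulr_sumr.
Qed.

Lemma conv_odd_T_coef_insert s :
  conv odd_coef (T_coef (1%N :: s)) p + conv odd_coef (T_coef (rcons s 1%N)) p
  + \sum_(j < size s) \sum_(1 <= a < (nth 0 s j).+1)
      conv odd_coef (T_coef (take j s ++ [:: a; (nth 0 s j + 1 - a)%N] ++ drop j.+1 s)) p
  = 0.
Proof.
have := conv_odd_log_derive _ _ (T_coef_cons0 1 s) (leqnn p).
rewrite pcharf0 // mul0r => sum0; rewrite [RHS]sum0.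
(* The value of [conv] at [p] involves only coefficients of index below [p], where division is
   harmless. *)
rewrite (eq_conv _ _ _ _ (fun m => T_coef1 s m)) convC.
rewrite (eq_conv _ _ _ _ (conv_odd_log_T_coef s)) convD conv_sum.
rewrite [RHS]addrC addrA; congr (_ + _ + _).
by apply: eq_bigr => j _; rewrite conv_sum.
Qed.

End Characteristic.

(** The bound [N] is left free so that induction on [s] can peel off $n_1$, which then bounds the
    remaining chain. *)
Lemma sum_parity_chains p s N : (0 < N <= p)%N ->
  \sum_(n : (size s).-tuple 'I_p |
      [&& path gtn N (map val n), all (fun i : 'I_p => 0 < i)%N n
        & [forall j, (tnth n j == size s - j %[mod 2])%N]])
    \prod_(j < size s) ((tnth n j)%:R ^+ nth 0%N s j : F)^-1
  = \sum_(0 <= m < N | ~~ odd (m + size s)) T_coef s m.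
Proof.
elim: s N => [|k s IHs] N /andP[N_gt0 le_Np].
  rewrite (eq_bigl (pred1 [tuple])) => [|n]; last first.
    by rewrite [RHS](introT eqP (tuple0 n)) (tuple0 n) /=; apply/forallP; case.
  rewrite big_pred1_eq big_ord0 big_mkcond big_ltn //= big_nat big1 ?addr0 //.
  by case=> // m _ /=; rewrite if_same.
pose consT (u : 'I_p * (size s).-tuple 'I_p) := [tuple of u.1 :: u.2].
rewrite (reindex consT) /=; last first.
  exists (fun n => (thead n, [tuple of behead n])) => [[x n] _ | n _].
    by congr (_, _); apply: val_inj.
  by case/tupleP: n => x n; apply: val_inj.
transitivity (\sum_(x < p | [&& x < N, 0 < x & ~~ odd (x + (size s).+1)]%N)
  \sum_(n : (size s).-tuple 'I_p |
      [&& path gtn x (map val n), all (fun i : 'I_p => 0 < i)%N n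
        & [forall j, (tnth n j == size s - j %[mod 2])%N]])
    (x%:R ^+ k : F)^-1 * \prod_(j < size s) ((tnth n j)%:R ^+ nth 0%N s j)^-1).
  rewrite pair_big_dep /=; apply: eq_big => [[x n] | [x n] _] /=.
    have -> : [forall j, tnth (consT (x, n)) j == (size s).+1 - j %[mod 2]] =
       ~~ odd (x + (size s).+1) && [forall j, tnth n j == size s - j %[mod 2]].
      apply/forallP/andP => [H | [H0 /forallP H] j].
        split; last by apply/forallP => j; have := H (lift ord0 j); rewrite tnthS /= subSS.
        by have := H ord0; rewrite tnth0 subn0 /=; lia.
      case: (unliftP ord0 j) => [i ->|->]; first by rewrite tnthS /= subSS.
      by rewrite tnth0 subn0 /=; lia.
    by rewrite -!andbA; do !bool_congr.
  rewrite big_ord_recl tnth0 /=; congr (_ * _).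
  by apply: eq_bigr => j _; rewrite tnthS.
rewrite (big_nat_widen _ _ _ _ _ le_Np) big_mkord.
(* The right-hand side also runs over $x = 0$, where the coefficient vanishes. *)
rewrite [RHS](bigID (fun x : 'I_p => 0 < x)%N) /= [X in _ + X]big1 ?addr0; last first.
  by move=> x /andP[_]; rewrite -eqn0Ngt => /eqP->; rewrite /conv big_geq ?mulr0.
apply: eq_big => [x|x /and3P[_ x_gt0 odd_x]]; first by do !bool_congr.
rewrite -mulr_sumr IHs ?x_gt0 ?(ltnW (ltn_ord x)) // conv_odd_coef; congr (_ * _).
(* Since [x + size s] is odd, [m + size s] is even exactly when [x - m] is odd. *)
rewrite [LHS]big_nat_cond [RHS]big_nat_cond; apply: eq_bigl => m.
by apply: andb_id2l => /andP[_ lt_mx]; lia.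
Qed.

End Convolution.

(** In even depth $n_1$ must be even; for odd [p] this says that $p - n_1$ is odd, which is what the
    factor $g$ selects. *)
Lemma T_p_conv (s : seq nat) p : odd p -> ~~ odd (size s) ->
  T_p s p = conv odd_coef (T_coef s) p.
Proof.
move=> odd_p even_s; rewrite conv_odd_coef.
transitivity (\sum_(0 <= m < p | ~~ odd (m + size s)) (T_coef s m : 'F_p)).
  rewrite -(@sum_parity_chains _ p) ?leqnn ?andbT ?odd_gt0 //.
  apply: eq_bigl => n; rewrite andbA andbA; congr (_ && _ && _).
  by case: n => -[|x n] //= _; rewrite ltn_ord.
rewrite [LHS]big_nat_cond [RHS]big_nat_cond; apply: eq_bigl => m.
by apply: andb_id2l => /andP[_ lt_mx]; lia.
Qed.

Lemma T_p_insert (d : nat) (s : d.-tuple nat) p : odd p -> prime p -> odd d ->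
  T_p (1%N :: s) p + T_p (rcons s 1%N) p
  + \sum_(j < d) \sum_(1 <= a < (tnth s j).+1)
      T_p (take j s ++ [:: a; (tnth s j + 1 - a)%N] ++ drop j.+1 s) p = 0.
Proof.
under eq_bigr => j _ do rewrite (tnth_nth 0%N).
case: s => s /= /eqP <- odd_p pr_p odd_s; rewrite !T_p_conv ?size_rcons //= ?odd_s //.
rewrite -[RHS](conv_odd_T_coef_insert p (pchar_Fp pr_p) s); congr (_ + _).
apply: eq_bigr => j _; apply: eq_bigr => a _; apply: T_p_conv => //.
(* The insertion raises the depth to $d + 1$, which is even. *)
have lt_js := ltn_ord j.
by rewrite size_cat /= size_takel ?size_drop ?(ltnW lt_js) //; lia.
Qed.

Lemma pi_calAD (x y : prodFp) : \pi_calA%qT (x + y) = \pi_calA%qT x + \pi_calA%qT y.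
Proof. exact: raddfD. Qed.

Lemma pi_calA_sum (I : Type) (r : seq I) (f : I -> prodFp) :
  \pi_calA%qT (\sum_(i <- r) f i) = \sum_(i <- r) \pi_calA%qT (f i).
Proof. exact: raddf_sum. Qed.

Lemma prodFp_sumE (I : Type) (r : seq I) (f : I -> prodFp) (q : primeT) :
  (\sum_(i <- r) f i) q = \sum_(i <- r) f i q.
Proof. exact: (big_morph (fun x : prodFp => x q)). Qed.

Theorem theorem3p4 (d : nat) (d_odd : odd d) (s : d.-tuple nat)
    (s_gt0 : forall j : 'I_d, (0 < tnth s j)%N) :
  T_A (1%N :: s) + T_A (rcons s 1%N)
  + \sum_(j < d) \sum_(1 <= a < (tnth s j).+1)
      T_A (take j s ++ [:: a; (tnth s j + 1 - a)%N] ++ drop j.+1 s) = 0.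
Proof.
under eq_bigr => j _ do rewrite -pi_calA_sum.
rewrite -pi_calA_sum -!pi_calAD -[RHS](raddf0 \pi_calA%qT).
(* The identity holds in ['F_p] for every odd prime, so 2 is the only possible exception. *)
apply/calA_eqP; apply: (@sub_finite_set _ _ [set exist (fun p => prime p) 2 isT]%classic) => //.
case=> p pr_p /= neq0; apply: val_inj => /=; apply/eqP.
have [->//|odd_p] := even_prime pr_p; case/negP: neq0; apply/eqP.
rewrite -[RHS](T_p_insert _ s p odd_p pr_p d_odd); congr (_ + _).
by rewrite prodFp_sumE; apply: eq_bigr => j _; rewrite prodFp_sumE.
Qed.
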